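(* Let $r\colon \mathbb{R}^2\to(0,\infty)$ be a function such that (i) $r$ is continuous, (ii) $\limsup_{|x|\to\infty}\,(r(x)-|x|)<\infty$, (iii) $\liminf_{|x|\to\infty}\,(r(x)-|x|)=-\infty$. Let $f\colon\mathbb{R}^2\to(-\infty,\infty]$ be a lower semicontinuous function such that $$\liminf_{|x|\to\infty}\frac{f(x)}{\ln|x|}\ge 0$$ and such that $f$ is $(\sigma,r)$-supermedian, that is, $$\sigma_{x,r(x)}(f):=\frac1{2\pi}\int_0^{2\pi} f\bigl(x+r(x)e^{it}\bigr)\,dt\le f(x)\qquad\text{for every }x\in\mathbb{R}^2.$$ Then $f$ is constant.
   Context: $\mathbb{R}^2$ is identified with $\mathbb{C}$, and $|\cdot|$ is the Euclidean norm. The function $f$ may take the value $+\infty$ but not $-\infty$; since $f$ is lower semicontinuous and $>-\infty$, it is bounded below on compact sets, so the circular averages are well defined in $(-\infty,\infty]$. ''Constant'' allows the constant value $+\infty$. *)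

(* Defs.v *)
From HB Require Import structures.
From mathcomp Require Import all_boot all_order all_algebra.
From mathcomp Require Import all_classical all_reals all_analysis.
Set Implicit Arguments.
Unset Strict Implicit.
Unset Printing Implicit Defensive.
Import Order.TTheory GRing.Theory Num.Theory.
Import numFieldNormedType.Exports.
Local Open Scope classical_set_scope.
Local Open Scope ring_scope.

(* The plane is R * R.  Its library topology is the product topology, i.e. the
   Euclidean one, but its library norm `|x| is the sup norm, which is why the
   Euclidean norm is defined here. *)
Definition enorm (R : realType) (x : R * R) : R :=
  Num.sqrt (x.1 ^+ 2 + x.2 ^+ 2).

(* The filter of |x| --> +oo, for use with limf_esup and limf_einf. *)
Definition plane_infty (R : realType) : set_system (R * R) :=
  filter_from [set: R] (fun M => [set x | M < enorm x]).
Arguments plane_infty R : clear implicits.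

(* The point x + rho * e^(it). *)
Definition circle_pt (R : realType) (x : R * R) (rho t : R) : R * R :=
  (x.1 + rho * cos t, x.2 + rho * sin t).

(* sigma_{x,rho}(f).  The integral of an \bar R-valued function is the integral
   of its positive part minus that of its negative part; the latter is finite
   when f is lower semicontinuous and > -oo. *)
Definition circle_mean (R : realType) (f : R * R -> \bar R)
    (x : R * R) (rho : R) : \bar R :=
  (((2 * pi)^-1)%:E *
    \int[lebesgue_measure]_(t in `[0%R, (2 * pi)%R]) f (circle_pt x rho t))%E.

Definition supermedian (R : realType) (r : R * R -> R)
    (f : R * R -> \bar R) : Prop :=
  forall x, (circle_mean f x (r x) <= f x)%E.

#[global] Instance plane_infty_filter (R : realType) :
  ProperFilter (plane_infty R).
Proof.
apply: filter_from_proper; last first.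
  move=> M _; exists (`|M| + 1, 0) => /=.
  rewrite /enorm /= expr0n addr0 sqrtr_sqr ger0_norm ?addr_ge0 //.
  by rewrite (le_lt_trans (ler_norm M)) // ltrDl.
apply: filter_from_filter; first by exists 0.
move=> M N _ _; exists (Num.max M N) => // x /=.
by rewrite gt_max => /andP.
Qed.

(* Main.v *)
Require Import Defs.
From HB Require Import structures.
From mathcomp Require Import all_boot all_order all_algebra.
From mathcomp Require Import all_classical all_reals all_analysis.
From mathcomp Require Import measurable_realfun.
From mathcomp Require Import ring lra.
Import Order.TTheory GRing.Theory Num.Theory.
Import numFieldNormedType.Exports.
Local Open Scope classical_set_scope.
Local Open Scope ring_scope.

Set Implicit Arguments.
Unset Strict Implicit.
Unset Printing Implicit Defensive.

(** The proof has an analytic and a topological half.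

    Analytic half: [f] attains its minimum ([supermedian_attains_min]).  Since
    [r <= |x| + M], the function
    [barrier C y = 2 ln (1 + |y|^2) - ln (C + |y|^2)] has, for [C] large and
    [y] outside some disk, a mean over the circle about [y] that does not exceed
    its value at [y]
    ([barrier_supermean]).  Circular means of [ln (C + |y|^2)] are explicit
    ([log_mean_circle]), because on a circle [C + |y|^2] is the squared modulus
    of [a + b e^(it)] with [b < a], and the mean of [ln |a + b e^(it)|^2] is
    [ln a^2]; so the inequality is purely algebraic ([drift_ineq]).  As the
    barrier grows at least like the logarithm, adding a small multiple of it to
    [f] gives a function that tends to infinity, and the minimum principle
    confines its minimum to a fixed disk.  The multiple then tends to zero.

    Topological half: let [A] be the closed nonempty set where [f] is minimal.
    If [x] is in [A], then [f] is minimal on the whole circle of radius [r x]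
    about [x], by rigidity of the mean ([circle_mean_rigidity]), so that this
    circle lies in [A].  Suppose that some [y] is not in [A].  Then no circle
    with centre [x] in [A] passes through [y], so whether it encloses [y] does
    not change as [x] moves along a connected part of [A].  The circle about the
    point of [A] nearest to [y] encloses [y]; it is a curve around [y] inside
    [A], and taking the outermost or the innermost points of the circles about
    its points produces further such curves.  Sweeping the plane with these
    circles shows that [A] contains the exterior of a disk about [y]
    ([exterior_subset]).  The condition on the lower limit of [r x - |x|] gives a
    point far out whose circle does not enclose [y]; hence no circle centred in
    the exterior does, and such circles, whose radii are bounded below, extend
    the exterior inward step by step ([exterior_shrink]) until it contains [y],
    a contradiction. *)

(** * Polar coordinates in the Euclidean plane *)

Section Plane.
Context {R : realType}.
Implicit Types x y z : R * R.

Lemma enorm_ge0 x : 0 <= enorm x.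
Proof. exact: sqrtr_ge0. Qed.

Lemma sqr_enorm x : enorm x ^+ 2 = x.1 ^+ 2 + x.2 ^+ 2.
Proof. by rewrite sqr_sqrtr // addr_ge0 ?sqr_ge0. Qed.

Lemma enormB_sym x y : enorm (x - y) = enorm (y - x).
Proof. by rewrite /enorm /=; congr Num.sqrt; ring. Qed.

Lemma enorm_triangle x y : enorm (x + y) <= enorm x + enorm y.
Proof.
rewrite -(@ler_pXn2r _ 2) ?nnegrE ?addr_ge0 ?enorm_ge0 //.
rewrite sqrrD !sqr_enorm /=.
suff : x.1 * y.1 + x.2 * y.2 <= enorm x * enorm y by nra.
apply: le_trans (ler_norm _) _.
rewrite -(@ler_pXn2r _ 2) ?nnegrE ?mulr_ge0 ?enorm_ge0 ?normr_ge0 //.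
rewrite real_normK ?num_real // exprMn !sqr_enorm.
by have := sqr_ge0 (x.1 * y.2 - x.2 * y.1); nra.
Qed.

Lemma continuous_enorm : continuous (@enorm R).
Proof.
move=> x; apply: (@continuous_comp _ _ _ (fun x : R * R => x.1 ^+ 2 + x.2 ^+ 2)
   Num.sqrt); last exact: sqrt_continuous.
by apply: cvgD; apply: cvgM; (exact: cvg_fst || exact: cvg_snd).
Qed.

Lemma enorm_circle_pt x (rho t : R) : 0 <= rho ->
  enorm (circle_pt x rho t - x) = rho.
Proof.
move=> rho0; rewrite /enorm /circle_pt /= !(addrC x.1, addrC x.2) !addrK.
by rewrite !exprMn -mulrDr cos2Dsin2 mulr1 sqrtr_sqr ger0_norm.
Qed.

(** The arccosine gives an angle in the upper half plane; the lower half plane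
    is reached by reflecting it. *)
Lemma polar_angle (a b : R) : a ^+ 2 + b ^+ 2 = 1 ->
  exists2 t, 0 <= t <= 2 * pi & a = cos t /\ b = sin t.
Proof.
move=> ab1; have a1 : -1 <= a <= 1.
  by apply/andP; split; nra.
have pi0 := pi_ge0 R.
have acosE : cos (acos a) = a by apply: acosK; rewrite in_itv.
have sE : sin (acos a) = `|b|.
  by rewrite sin_acos // -sqrtr_sqr -ab1 addrAC subrr add0r.
have h0 := acos_ge0 a1; have h1 := acos_lepi a1.
case: (leP 0 b) => b0.
  exists (acos a); first by lra.
  by rewrite acosE sE ger0_norm.
exists (2 * pi - acos a); first by lra.
have e : 2 * pi - acos a = - acos a + pi *+ 2 by rewrite mulr_natl addrC.
by rewrite e cosD2pi sinD2pi cosN sinN acosE sE ltr0_norm ?opprK.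
Qed.

Lemma circle_ptP x z (rho : R) : 0 <= rho -> enorm (z - x) = rho ->
  exists2 t, 0 <= t <= 2 * pi & z = circle_pt x rho t.
Proof.
rewrite le_eqVlt => /predU1P[<-|rho0] zx.
  have := sqr_enorm (z - x); rewrite zx expr0n /= => /esym/eqP.
  rewrite paddr_eq0 ?sqr_ge0 // !sqrf_eq0 !subr_eq0 => /andP[/eqP e1 /eqP e2].
  exists 0; first by rewrite lexx mulr_ge0 ?pi_ge0.
  by rewrite [LHS]surjective_pairing /circle_pt !mul0r !addr0 e1 e2.
have rho_neq0 : rho != 0 by rewrite gt_eqF.
have e := sqr_enorm (z - x); rewrite zx /= in e.
have [|t t2 [et1 et2]] := @polar_angle ((z.1 - x.1) / rho) ((z.2 - x.2) / rho).
  by rewrite !expr_div_n -mulrDl -e divff // expf_neq0.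
exists t => //; rewrite [LHS]surjective_pairing /circle_pt -et1 -et2.
by congr pair; field.
Qed.

Lemma continuous_circle_pt x (rho : R -> R) : continuous rho ->
  continuous (fun t => circle_pt x (rho t) t).
Proof.
move=> crho t; apply: (@cvg_pair _ _ _ _ (nbhs (x.1 + rho t * cos t))
  (nbhs (x.2 + rho t * sin t))); (apply: cvgD; first exact: cvg_cst);
  (apply: cvgM; first exact: crho).
- exact: continuous_cos.
- exact: continuous_sin.
Qed.

Lemma circle_pt_pi x (rho t : R) : circle_pt x rho (t + pi) = circle_pt x (- rho) t.
Proof. by rewrite /circle_pt cosDpi sinDpi !mulrN !mulNr. Qed.

Lemma circle_pt_radial x (a b t : R) :
  circle_pt (circle_pt x a t) b t = circle_pt x (a + b) t.
Proof. by rewrite /circle_pt /=; congr pair; ring. Qed.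

(** On the line through [x] with direction [t], the radius is an isometric
    coordinate; negative radii are the points on the opposite ray. *)
Lemma enorm_circle_ptB x (a b t : R) :
  enorm (circle_pt x a t - circle_pt x b t) = `|a - b|.
Proof.
rewrite /enorm /circle_pt /= -sqrtr_sqr; congr Num.sqrt.
transitivity ((a - b) ^+ 2 * (cos t ^+ 2 + sin t ^+ 2)); first by ring.
by rewrite cos2Dsin2 mulr1.
Qed.

End Plane.

(** * The equation for circular means of logarithms *)

Section Drift.
Context {R : realType}.
Implicit Types C x r P Q : R.

(** On the circle of radius [r] about a point at distance [x] from the origin,
    [C + |z|^2] equals [|a + b e^(it)|^2] up to a rotation, where
    [a^2 + b^2 = C + x^2 + r^2] and [a b = x r].  The roots of this polynomial
    in [P] are [a^2] and [b^2]; the larger one is the exponential of the mean of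
    [ln (C + |z|^2)] over that circle. *)
Definition drift_poly C x r P := P ^+ 2 - (C + x ^+ 2 + r ^+ 2) * P + x ^+ 2 * r ^+ 2.

Lemma sqr_le x r : 0 <= x -> x <= r -> x ^+ 2 <= r ^+ 2.
Proof. by nra. Qed.

(** The equation for the larger root reads [(Q - r^2) (Q - x^2) = Q].  If
    [Q - r^2] were small compared with [x], then [r <= x + M] would keep
    [Q - x^2] of order at most [x], and the product would fall below
    [x^2 < Q]. *)
Lemma drift_bound_lower M x r Q : 1 <= M -> 0 < r -> r <= x + M -> M <= x ->
  x ^+ 2 < Q -> r ^+ 2 < Q -> drift_poly 1 x r Q = 0 ->
  x <= 16 * M * (Q - r ^+ 2).
Proof.
rewrite /drift_poly => M1 r0 rxM Mx xQ rQ e.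
have e1 : (Q - r ^+ 2) * (Q - x ^+ 2) = Q by lra.
set w := Q - r ^+ 2 in e1 *.
have w0 : 0 < w by rewrite /w; lra.
rewrite leNgt; apply/negP => lt.
have Mw : M * w < x / 16 by lra.
have h : Q - x ^+ 2 <= w + 3 * M * x by rewrite /w; nra.
have : Q < x ^+ 2.
  rewrite -e1; have wx: w < x / 16 by nra.
  have : w * (Q - x ^+ 2) <= w * (w + 3 * M * x) by rewrite ler_pM2l.
  nra.
lra.
Qed.

Lemma larger_root_ge C x r P T : drift_poly C x r P = 0 ->
  C + x ^+ 2 + r ^+ 2 <= 2 * P -> drift_poly C x r T <= 0 -> T <= P.
Proof.
rewrite /drift_poly => e v le; rewrite leNgt; apply/negP => lt.
suff : 0 < (T - P) * (T + P - (C + x ^+ 2 + r ^+ 2)) by lra.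
by rewrite mulr_gt0; lra.
Qed.

Lemma larger_root_gt C x r P T : drift_poly C x r P = 0 ->
  C + x ^+ 2 + r ^+ 2 <= 2 * P -> drift_poly C x r T < 0 -> T < P.
Proof.
move=> e v lt; rewrite lt_neqAle (larger_root_ge e) ?(ltW lt) // andbT.
by apply: contraTneq lt => ->; rewrite e ltxx.
Qed.

(** The algebraic form of the negative drift.  Passing from the centre to the
    circular mean multiplies [1 + x^2] by [k = Q / (1 + x^2)], and the claim is
    that it multiplies [C + x^2] by at least [k^2].  By [larger_root_ge] this
    amounts to the sign of the polynomial at [k^2 (C + x^2)].  With
    [w = Q - r^2] and [v = Q - (1 + x^2)], the equation for [Q] is [w v = r^2],
    and that value is [v] times a difference whose positive part is at most
    [6 (w + 2 v + 4 C)] and whose negative part is [C w].  As [w] is at least of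
    order [x / M], both [v] and [C] are dominated by multiples of [w], so that a
    [C] of order [M^2] suffices. *)
Lemma drift_ineq M N C x r P Q : 1 <= M -> N = 32 * M -> C = 14 * N ^+ 2 ->
  2 * N * C <= x -> 0 < r -> r <= x + M ->
  drift_poly 1 x r Q = 0 -> 1 + x ^+ 2 + r ^+ 2 <= 2 * Q ->
  drift_poly C x r P = 0 -> C + x ^+ 2 + r ^+ 2 <= 2 * P ->
  Q ^+ 2 * (C + x ^+ 2) <= P * (1 + x ^+ 2) ^+ 2.
Proof.
move=> M1 NE CE xC r0 rxM eQ vQ eP vP.
have N1 : 16 <= N by lra.
have N2 : N <= N ^+ 2 by rewrite expr2 ler_peMl; lra.
have C1 : 1 <= C by lra.
have CM : M <= C by lra.
have MC : C <= N * C by rewrite ler_peMl; lra.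
have x0 : 0 < x by lra.
have xQ : x ^+ 2 < Q.
  by apply: larger_root_gt eQ vQ _; rewrite /drift_poly; nra.
have rQ : r ^+ 2 < Q.
  by apply: larger_root_gt eQ vQ _; rewrite /drift_poly; nra.
have wx : 2 * x <= N * (Q - r ^+ 2).
  have : x <= 16 * M * (Q - r ^+ 2) by apply: drift_bound_lower eQ => //; lra.
  by rewrite NE; lra.
set D1 := 1 + x ^+ 2; set D := C + x ^+ 2.
set w := Q - r ^+ 2 in wx; set v := Q - D1.
have D1_gt0 : 0 < D1 by rewrite /D1; nra.
have w0 : 0 < w by rewrite /w; lra.
have wv : w * v = r ^+ 2 by move: eQ; rewrite /drift_poly /w /v /D1; lra.
have v0 : 0 < v by rewrite -(pmulr_rgt0 _ w0) wv exprn_gt0.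
have wC : 4 * C <= w.
  have : N * (4 * C) <= N * w by lra.
  by rewrite ler_pM2l //; lra.
have r2x : r <= 2 * x by lra.
have vw : v <= N ^+ 2 * w.
  rewrite -(ler_pM2l w0) wv.
  have : r ^+ 2 <= (N * w) ^+ 2 by apply: sqr_le; lra.
  by rewrite exprMn; lra.
have DD1 : D <= 2 * D1 by rewrite /D /D1; nra.
have QD1 : Q <= 2 * D1.
  rewrite leNgt; apply/negP => lt.
  have vD1 : D1 < v by rewrite /v; lra.
  have r2 : r ^+ 2 <= (x + M) ^+ 2 by apply: sqr_le; lra.
  have xM : 6 * M <= x by lra.
  have r3 : 2 * r ^+ 2 <= 3 * D1 by rewrite /D1; nra.
  have wD1 : D1 < 2 * w by rewrite /w; lra.
  have D1_ge3 : 3 <= D1 by rewrite /D1; nra.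
  nra.
have D0 : 0 < D by rewrite /D; nra.
have Q0 : 0 < Q by nra.
rewrite -ler_pdivrMr ?exprn_gt0 //; apply: larger_root_ge eP vP _.
set k := Q / D1.
have kD1 : Q = k * D1 by rewrite /k divfK // gt_eqF.
have k1 : 1 <= k by rewrite /k ler_pdivlMr // mul1r; rewrite /v in v0; lra.
have k2 : k <= 2 by rewrite /k ler_pdivrMr.
have -> : Q ^+ 2 * D / D1 ^+ 2 = k ^+ 2 * D by rewrite /k; field; rewrite gt_eqF.
set l := D / D1.
have lD1 : D = l * D1 by rewrite /l divfK // gt_eqF.
have l0 : 0 < l by rewrite divr_gt0.
have l2 : l <= 2 by rewrite /l ler_pdivrMr.
have vk : v = (k - 1) * D1 by rewrite /v kD1; ring.
have -> : drift_poly C x r (k ^+ 2 * D) =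
    v * ((k + 1) * l * (k ^+ 2 * D - r ^+ 2) - C * w).
  rewrite /drift_poly.
  transitivity ((k ^+ 2 - 1) * D * (k ^+ 2 * D - r ^+ 2) - C * r ^+ 2).
    by rewrite /D; ring.
  by rewrite -wv vk [D in (_ - 1) * D]lD1; ring.
rewrite pmulr_rle0 // subr_le0.
have b : k ^+ 2 * D - r ^+ 2 <= w + 2 * v + 4 * C.
  have -> : k ^+ 2 * D - r ^+ 2 = w + k * v + k ^+ 2 * (C - 1).
    have -> : D = D1 + (C - 1) by rewrite /D /D1; ring.
    by rewrite /w vk kD1; ring.
  have : k * v <= 2 * v by rewrite ler_pM2r.
  have : k ^+ 2 * (C - 1) <= 4 * (C - 1) by rewrite ler_wpM2r //; nra.
  lra.
have kl0 : 0 <= (k + 1) * l by rewrite mulr_ge0; lra.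
have kl : (k + 1) * l <= 6 by nra.
have := ler_wpM2l kl0 b.
have b0 : 0 <= w + 2 * v + 4 * C by lra.
have := ler_wpM2r b0 kl.
have : 6 * (w + 2 * v + 4 * C) <= C * w.
  have : 6 * w <= N ^+ 2 * w by rewrite ler_pM2r //; lra.
  have -> : C * w = 14 * (N ^+ 2 * w) by rewrite CE; ring.
  lra.
lra.
Qed.
End Drift.

(** * Integrals of periodic functions *)

Section PeriodIntegral.
Context {R : realType}.
Local Notation mu := (@lebesgue_measure R).
Implicit Types (g : R -> R) (a b t : R).

Definition period_integral g : R := \int[mu]_(t in `[0, 2 * pi]) g t.

Lemma integrable_continuous g a b : continuous g ->
  mu.-integrable `[a, b] (EFin \o g).
Proof.
move=> cg; apply: continuous_compact_integrable; first exact: segment_compact.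
exact: continuous_subspaceT.
Qed.

(** Working with an antiderivative on a half line turns shifts and dilations of
    the integration variable into the chain rule. *)
Lemma antiderivative g b : continuous g ->
  exists G : R -> R, forall t, b < t -> is_derive t (1 : R) G (g t).
Proof.
move=> cg; exists (fun x => \int[mu]_(t in `[b, x]) g t) => t bt.
have t1 : t < t + 1 by lra.
have [d e] := continuous_FTC1_closed t1 (@integrable_continuous g b (t + 1) cg) bt (cg t).
by apply: DeriveDef => //; rewrite -derive1E.
Qed.

Lemma integral_antiderivative g (G : R -> R) a b : a < b -> continuous g ->
  (forall t, a <= t <= b -> is_derive t (1 : R) G (g t)) ->
  \int[mu]_(t in `[a, b]) g t = G b - G a.
Proof.
move=> ab cg dG.
have cG t : a <= t <= b -> {for t, continuous G}.
  by move=> /dG dt; apply: differentiable_continuous; apply/derivable1_diffP.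
rewrite /Rintegral (@continuous_FTC2 _ g G a b) //.
- exact: continuous_subspaceT.
- split.
  + move=> t; rewrite in_itv /= => /andP[at_ tb].
    by have /dG [] : a <= t <= b by rewrite !ltW.
  + by apply: cvg_at_right_filter; apply: cG; rewrite lexx ltW.
  + by apply: cvg_at_left_filter; apply: cG; rewrite lexx ltW.
- move=> t; rewrite in_itv /= => /andP[at_ tb]; rewrite derive1E.
  by have /dG [_ ->] : a <= t <= b by rewrite !ltW.
Qed.

Lemma is_derive_shift (G : R -> R) t a l : is_derive (t + a) (1 : R) G l ->
  is_derive t (1 : R) (fun s => G (s + a)) l.
Proof.
move=> dG; have d1 : is_derive t (1 : R) (fun s => s + a) (1 + 0).
  by apply: is_deriveD.
rewrite addr0 in d1; rewrite -[l]mulr1.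
exact: (@is_derive1_comp _ G (fun s => s + a) t l 1 dG d1).
Qed.

Lemma is_derive_dilate (G : R -> R) t l : is_derive (2 * t) (1 : R) G l ->
  is_derive t (1 : R) (fun s => G (2 * s)) (l * 2).
Proof.
move=> dG; have d1 : is_derive t (1 : R) (fun s => 2 * s) (2 *: 1).
  exact: (@is_deriveZ _ _ _ id 2 t 1 1).
rewrite /GRing.scale /= mulr1 in d1.
exact: (@is_derive1_comp _ G (fun s => 2 * s) t l 2 dG d1).
Qed.

(** The increment of an antiderivative over one period does not depend on where
    the period starts, since that increment has derivative zero. *)
Lemma period_antiderivative g a : continuous g -> periodic g (2 * pi) ->
  0 <= a -> exists2 G : R -> R, forall t, 0 <= t -> is_derive t (1 : R) G (g t) &
    G (a + 2 * pi) - G a = period_integral g.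
Proof.
move=> cg pg; have [G dG] := antiderivative (- 1) cg.
have pi0 := pi_gt0 R.
have dG0 t : 0 <= t -> is_derive t (1 : R) G (g t) by move=> t0; apply: dG; lra.
have e0 : period_integral g = G (2 * pi) - G 0.
  apply: integral_antiderivative => //; first by lra.
  by move=> t /andP[/dG0].
rewrite le_eqVlt => /predU1P[<-|a0]; exists G => //.
  by rewrite add0r e0.
have e : \int[mu]_(t in `[0, a]) (cst 0 t : R) =
    (G (a + 2 * pi) - G a) - (G (0 + 2 * pi) - G 0).
  apply: (@integral_antiderivative (cst 0) (fun t => G (t + 2 * pi) - G t)) => //.
    by move=> t; exact: cvg_cst.
  move=> t /andP[t0 _]; rewrite /= -[0](subrr (g t)) -{1}(pg t).
  by apply: is_deriveB; [apply: is_derive_shift; apply: dG0; lra|exact: dG0].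
move: e; rewrite /Rintegral integral0 /= add0r e0.
by move=> /esym/eqP; rewrite subr_eq0 => /eqP.
Qed.

Lemma period_integral_shift g a : continuous g -> periodic g (2 * pi) ->
  0 <= a -> period_integral (fun t => g (t + a)) = period_integral g.
Proof.
move=> cg pg a0; have [G dG <-] := period_antiderivative cg pg a0.
have pi0 := pi_gt0 R.
transitivity (G (2 * pi + a) - G (0 + a)); last by rewrite add0r (addrC a).
apply: (@integral_antiderivative _ (fun t => G (t + a))).
- lra.
- by move=> t; apply: (@continuous_comp _ _ _ (fun s : R => s + a) g);
    [apply: cvgD; [exact: cvg_id|exact: cvg_cst]|exact: cg].
- by move=> t /andP[t0 _]; apply: is_derive_shift; apply: dG; lra.
Qed.

(** As [t] runs over one period, [2 t] runs over two. *)
Lemma period_integral_dilate g : continuous g -> periodic g (2 * pi) ->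
  period_integral (fun t => g (2 * t)) = period_integral g.
Proof.
move=> cg pg; have pi0 := pi_gt0 R.
have pi20 : 0 <= 2 * pi :> R by lra.
have [G dG e1] := period_antiderivative cg pg pi20.
have e0 : G (2 * pi) - G 0 = period_integral g.
  apply/esym/integral_antiderivative => //; first by lra.
  by move=> t /andP[/dG].
transitivity (G (2 * (2 * pi)) / 2 - G (2 * 0) / 2); last first.
  have -> : 2 * (2 * pi) = 2 * pi + 2 * pi :> R by ring.
  by rewrite mulr0; lra.
apply: (@integral_antiderivative _ (fun t => G (2 * t) / 2)).
- lra.
- by move=> t; apply: (@continuous_comp _ _ _ (fun s : R => 2 * s) g);
    [apply: cvgM; [exact: cvg_cst|exact: cvg_id]|exact: cg].
- move=> t /andP[t0 _].
  have dt : is_derive t (1 : R) (fun s => G (2 * s)) (g (2 * t) * 2).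
    by apply: is_derive_dilate; apply: dG; lra.
  have := is_deriveM dt (is_derive_cst (2^-1 : R) t (1 : R)).
  rewrite scaler0 add0r /GRing.scale /= => h.
  by have -> : g (2 * t) = 2^-1 * (g (2 * t) * 2) by field.
Qed.

Lemma period_integralD g h : continuous g -> continuous h ->
  period_integral (fun t => g t + h t) = period_integral g + period_integral h.
Proof.
by move=> cg ch; rewrite /period_integral RintegralD //; exact: integrable_continuous.
Qed.

Lemma period_integralZ (c : R) g : continuous g ->
  period_integral (fun t => c * g t) = c * period_integral g.
Proof.
by move=> cg; rewrite /period_integral RintegralZl //; exact: integrable_continuous.
Qed.

Lemma period_integral_cst (c : R) : period_integral (fun=> c) = 2 * pi * c.
Proof.
rewrite /period_integral Rintegral_cst //= [in fine _]lebesgue_measure_itv /=.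
rewrite lte_fin mulr_gt0 ?pi_gt0 // -EFinB /= subr0 mulrC //.
Qed.

Lemma le_period_integral g h : continuous g -> continuous h ->
  (forall t, g t <= h t) -> period_integral g <= period_integral h.
Proof.
move=> cg ch gh; apply: le_Rintegral => //; exact: integrable_continuous.
Qed.
End PeriodIntegral.

(** * Circular means of logarithms *)

Section LogMean.
Context {R : realType}.
Implicit Types (q t a b C r : R) (y : R * R).

Lemma cos_kernel_ge q t : (1 - `|q|) ^+ 2 <= 1 + q ^+ 2 + 2 * q * cos t.
Proof.
have c : `|q * cos t| <= `|q|.
  by rewrite normrM ler_piMr // cos_max.
rewrite sqrrB expr1n mul1r real_normK ?num_real //.
by move: c; rewrite ler_norml => /andP[]; lra.
Qed.

Lemma cos_kernel_le q t : `|q| <= 1 -> 1 + q ^+ 2 + 2 * q * cos t <= 4.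
Proof.
move=> q1; have c : `|q * cos t| <= `|q|.
  by rewrite normrM ler_piMr // cos_max.
have : q ^+ 2 <= 1 by rewrite -(@real_normK _ q) ?num_real // expr_le1.
by move: c; rewrite ler_norml => /andP[]; lra.
Qed.

Lemma cos_kernel_gt0 q t : `|q| < 1 -> 0 < 1 + q ^+ 2 + 2 * q * cos t.
Proof.
by move=> q1; apply: lt_le_trans (cos_kernel_ge q t); rewrite exprn_gt0 ?subr_gt0.
Qed.

Lemma continuous_ln_comp (g : R -> R) : continuous g -> (forall t, 0 < g t) ->
  continuous (fun t => ln (g t)).
Proof.
by move=> cg g0 t; apply: continuous_comp; [exact: cg|exact: continuous_ln].
Qed.

Lemma continuous_affine_cos a b : continuous (fun t => a + b * cos t).
Proof.
move=> t; apply: cvgD; first exact: cvg_cst.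
by apply: cvgM; [exact: cvg_cst|exact: continuous_cos].
Qed.

Lemma periodic_cos : periodic (@cos R) (2 * pi).
Proof. by move=> t; rewrite mulr_natl cosD2pi. Qed.

(** The integral of [ln |1 + q e^(it)|^2] over the circle. *)
Definition log_kernel_integral q : R :=
  period_integral (fun t => ln (1 + q ^+ 2 + 2 * q * cos t)).

Lemma continuous_log_kernel q : `|q| < 1 ->
  continuous (fun t => ln (1 + q ^+ 2 + 2 * q * cos t)).
Proof.
move=> q1; apply: continuous_ln_comp; first exact: continuous_affine_cos.
by move=> t; exact: cos_kernel_gt0.
Qed.

Lemma periodic_log_kernel q :
  periodic (fun t => ln (1 + q ^+ 2 + 2 * q * cos t)) (2 * pi).
Proof. by move=> t; rewrite periodic_cos. Qed.

Lemma log_kernel_integralN q : `|q| < 1 ->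
  log_kernel_integral (- q) = log_kernel_integral q.
Proof.
move=> q1; rewrite /log_kernel_integral.
rewrite -(period_integral_shift (continuous_log_kernel q1)
  (periodic_log_kernel q) (pi_ge0 R)).
by congr period_integral; apply/funext => t; rewrite cosDpi sqrrN; congr ln; ring.
Qed.

(** [|1 + q e^(it)|^2 |1 - q e^(it)|^2 = |1 - q^2 e^(2it)|^2], and replacing
    [q] by [- q] or [2 t] by [t] leaves the integrals unchanged. *)
Lemma log_kernel_integral_double q : `|q| < 1 ->
  2 * log_kernel_integral q = log_kernel_integral (q ^+ 2).
Proof.
move=> q1; have q21 : `|q ^+ 2| < 1 by rewrite normrX expr_lt1.
have qN1 : `|- q| < 1 by rewrite normrN.
have qN21 : `|- q ^+ 2| < 1 by rewrite normrN.
rewrite -(log_kernel_integralN q21) [RHS]/log_kernel_integral.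
rewrite -(period_integral_dilate (continuous_log_kernel qN21)
  (periodic_log_kernel _)).
rewrite mulr_natl mulr2n -{2}(log_kernel_integralN q1) -period_integralD;
  [|exact: continuous_log_kernel..].
congr period_integral; apply/funext => t.
rewrite -lnM ?posrE ?cos_kernel_gt0 //; congr ln.
by rewrite [2 * t]mulr_natl cos_mulr2n; ring.
Qed.

(** Iterating the doubling formula, [2^n] times the integral at [q] is the
    integral at [q^(2^n)], and these stay bounded. *)
Lemma log_kernel_integral_eq0 q : 0 <= q < 1 -> log_kernel_integral q = 0.
Proof.
move=> /andP[q0 q1]; have nq : `|q| = q by rewrite ger0_norm.
set K := 2 * pi * `|ln ((1 - q) ^+ 2)| + 2 * pi * `|ln 4|.
have pi0 := pi_gt0 R.
have bound p : 0 <= p <= q -> `|log_kernel_integral p| <= K.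
  move=> /andP[p0 pq]; have np : `|p| = p by rewrite ger0_norm.
  have p1 : `|p| < 1 by rewrite np; lra.
  have cp := continuous_log_kernel p1.
  have lo : period_integral (fun=> ln ((1 - q) ^+ 2)) <= log_kernel_integral p.
    apply: le_period_integral => //; first by move=> t; exact: cvg_cst.
    move=> t; rewrite ler_ln ?posrE ?cos_kernel_gt0 ?exprn_gt0 ?subr_gt0 //.
    by apply: le_trans (cos_kernel_ge p t); rewrite np; nra.
  have up : log_kernel_integral p <= period_integral (fun=> ln 4).
    apply: le_period_integral => //; first by move=> t; exact: cvg_cst.
    move=> t; rewrite ler_ln ?posrE ?cos_kernel_gt0 //.
    by apply: cos_kernel_le; lra.
  rewrite !period_integral_cst in lo up.
  have := ler_norm (- ln ((1 - q) ^+ 2)); rewrite normrN => n1.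
  have n2 := ler_norm (ln 4 : R).
  have h1 : 0 <= 2 * pi * `|ln ((1 - q) ^+ 2)| by rewrite !mulr_ge0 // ltW.
  have h2 : 0 <= 2 * pi * `|ln 4 : R| by rewrite !mulr_ge0 // ltW.
  have pi2 : 0 < 2 * pi :> R by lra.
  rewrite -(ler_pM2l pi2) in n1; rewrite -(ler_pM2l pi2) in n2.
  by rewrite ler_norml /K; apply/andP; split; lra.
have main n p : 0 <= p <= q -> 2 ^+ n * `|log_kernel_integral p| <= K.
  elim: n p => [|n IH] p p01; first by rewrite mul1r; exact: bound.
  rewrite exprSr -mulrA -[X in X * `|_|](@ger0_norm _ 2) // -normrM.
  rewrite log_kernel_integral_double; last first.
    by rewrite ger0_norm; move/andP : p01 => [? ?]; lra.
  by apply: IH; move/andP : p01 => [? ?]; apply/andP; split; nra.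
apply/eqP; rewrite -normr_le0 leNgt; apply/negP => I0.
have := main (Num.truncn (K / `|log_kernel_integral q|)).+1 q.
rewrite q0 lexx => /(_ isT); rewrite leNgt => /negP; apply.
rewrite -ltr_pdivrMr //; apply: lt_trans (truncnS_gt _) _.
by rewrite -natrX ltr_nat ltn_expl.
Qed.

(** The mean value property of [ln |a + z|^2], harmonic for [|z| < a]. *)
Lemma log_mean_cos a b : 0 <= b < a ->
  period_integral (fun t => ln (a ^+ 2 + b ^+ 2 + 2 * (a * b) * cos t)) =
  2 * pi * ln (a ^+ 2).
Proof.
move=> /andP[b0 ba]; have a0 : 0 < a by lra.
have q01 : 0 <= b / a < 1 
  by rewrite ltr_pdivrMr // mul1r ba andbT divr_ge0 // ltW.
have q1 : `|b / a| < 1 by case/andP: q01 => q0 q1; rewrite ger0_norm.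
have -> : (fun t => ln (a ^+ 2 + b ^+ 2 + 2 * (a * b) * cos t)) =
    (fun t => ln (a ^+ 2) + ln (1 + (b / a) ^+ 2 + 2 * (b / a) * cos t)).
  apply/funext => t; rewrite -lnM ?posrE ?cos_kernel_gt0 ?exprn_gt0 //.
  by congr ln; field; rewrite gt_eqF.
rewrite period_integralD; first last.
- exact: continuous_log_kernel.
- by move=> t; exact: cvg_cst.
by rewrite period_integral_cst -/(log_kernel_integral _) log_kernel_integral_eq0 ?addr0.
Qed.

(** The law of cosines; [p] is the polar angle of [y]. *)
Lemma sqr_enorm_circle_pt y r : exists2 p, 0 <= p <= 2 * pi &
  forall t, enorm (circle_pt y r t) ^+ 2 =
    enorm y ^+ 2 + r ^+ 2 + 2 * (enorm y * r) * cos (t - p).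
Proof.
have [|p p2 yE] := @circle_ptP R 0 y (enorm y) (enorm_ge0 y).
  by rewrite subr0.
exists p => // s; rewrite [LHS]sqr_enorm cosB /=.
move: yE; rewrite /circle_pt /= !add0r; set n := enorm y => yE.
rewrite [y]yE /=.
transitivity (n ^+ 2 * (cos p ^+ 2 + sin p ^+ 2) +
  r ^+ 2 * (cos s ^+ 2 + sin s ^+ 2) +
  2 * (n * r) * (cos s * cos p + sin s * sin p)); first by ring.
by rewrite !cos2Dsin2 !mulr1.
Qed.

Lemma log_mean_circle C y r : 0 < C -> 0 <= r ->
  exists P, [/\ 0 < P, drift_poly C (enorm y) r P = 0,
    C + enorm y ^+ 2 + r ^+ 2 <= 2 * P &
    period_integral (fun t => ln (C + enorm (circle_pt y r t) ^+ 2)) =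
      2 * pi * ln P].
Proof.
move=> C0 r0; set x := enorm y; have x0 : 0 <= x := enorm_ge0 y.
(* [u] and [v] are [a + b] and [a - b] for the factorisation
   [C + |z|^2 = |a + b e^(it)|^2] on the circle: they give the largest and the
   smallest value of [C + |z|^2] there. *)
set u := Num.sqrt (C + (x + r) ^+ 2); set v := Num.sqrt (C + (x - r) ^+ 2).
have u2 : u ^+ 2 = C + (x + r) ^+ 2.
  by rewrite sqr_sqrtr // addr_ge0 ?sqr_ge0 // ltW.
have v2 : v ^+ 2 = C + (x - r) ^+ 2.
  by rewrite sqr_sqrtr // addr_ge0 ?sqr_ge0 // ltW.
have v0 : 0 < v by rewrite sqrtr_gt0 ltr_wpDr // sqr_ge0.
have uv : v <= u by rewrite ler_sqrt //; nra.
pose a := (u + v) / 2; pose b := (u - v) / 2.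
have ab : 0 <= b < a by rewrite /a /b; lra.
have sE : a ^+ 2 + b ^+ 2 = C + x ^+ 2 + r ^+ 2.
  transitivity ((u ^+ 2 + v ^+ 2) / 2); first by rewrite /a /b; field.
  by rewrite u2 v2; field.
have pE : a * b = x * r.
  transitivity ((u ^+ 2 - v ^+ 2) / 4); first by rewrite /a /b; field.
  by rewrite u2 v2; field.
exists (a ^+ 2); split.
- by rewrite exprn_gt0 // /a; lra.
- by rewrite /drift_poly -sE -exprMn -pE; ring.
- by rewrite -sE; nra.
have [p /andP[p0 p2] yE] := sqr_enorm_circle_pt y r.
rewrite -(log_mean_cos ab).
have p3 : 0 <= 2 * pi - p by rewrite subr_ge0.
have cg : continuous (fun t => ln (a ^+ 2 + b ^+ 2 + 2 * (a * b) * cos t)).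
  apply: continuous_ln_comp; first exact: continuous_affine_cos.
  move=> t; rewrite sE pE.
  have := cos_max t; have : `|x * r * cos t| <= x * r.
    by rewrite normrM (@ger0_norm _ (x * r)) ?mulr_ge0 // ler_piMr ?cos_max ?mulr_ge0.
  rewrite ler_norml => /andP[]; nra.
rewrite -[RHS](period_integral_shift cg _ p3); last first.
  by move=> t; rewrite periodic_cos.
congr period_integral; apply/funext => t; rewrite yE sE pE.
have -> : t + (2 * pi - p) = t - p + 2 * pi by ring.
by rewrite periodic_cos !addrA.
Qed.

(** * A barrier growing like the logarithm *)

(** Up to bounded terms [barrier C] is [2 ln |y|] near infinity.  A circle of
    radius [|y| + M] may surround the origin, which rules out [ln |y|] itself:
    its circular mean is [ln (|y| + M)].  The negative charge that
    [- ln (C + |y|^2)] adds, spread over a larger scale than the positive charge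
    of [2 ln (1 + |y|^2)], compensates for this once [C] is large. *)
Definition barrier C y := 2 * ln (1 + enorm y ^+ 2) - ln (C + enorm y ^+ 2).

Lemma continuous_ln_enorm C : 0 < C ->
  continuous (fun y => ln (C + enorm y ^+ 2)).
Proof.
move=> C0 y; apply: (@continuous_comp _ _ _ (fun y => C + enorm y ^+ 2) (@ln R)).
  apply: cvgD; first exact: cvg_cst.
  by apply: cvgM; exact: continuous_enorm.
by apply: continuous_ln; rewrite ltr_wpDr // sqr_ge0.
Qed.

Lemma continuous_barrier C : 0 < C -> continuous (barrier C).
Proof.
move=> C0 y; apply: cvgB; last exact: continuous_ln_enorm.
by apply: cvgM; [exact: cvg_cst|exact: continuous_ln_enorm].
Qed.

Lemma barrier_supermean M N C y r : 1 <= M -> N = 32 * M -> C = 14 * N ^+ 2 ->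
  2 * N * C <= enorm y -> 0 < r -> r <= enorm y + M ->
  period_integral (fun t => barrier C (circle_pt y r t)) <= 2 * pi * barrier C y.
Proof.
move=> M1 NE CE yC r0 ryM.
have C0 : 0 < C by rewrite CE mulr_gt0 // exprn_gt0 //; lra.
have [Q [Q0 eQ vQ iQ]] := log_mean_circle y (@ltr01 R) (ltW r0).
have [P [P0 eP vP iP]] := log_mean_circle y C0 (ltW r0).
have ineq := drift_ineq M1 NE CE yC r0 ryM eQ vQ eP vP.
have cc : continuous (circle_pt y r).
  by apply: (@continuous_circle_pt R y (cst r)) => t; exact: cvg_cst.
have cl K : 0 < K -> continuous (fun t => ln (K + enorm (circle_pt y r t) ^+ 2)).
  move=> K0 t; apply: (@continuous_comp _ _ _ (circle_pt y r)
    (fun y => ln (K + enorm y ^+ 2))); [exact: cc|exact: continuous_ln_enorm].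
rewrite /barrier period_integralD; first last.
- by move=> t; apply: cvgN; exact: cl.
- by move=> t; apply: cvgM; [exact: cvg_cst|exact: cl].
have -> : (fun t => - ln (C + enorm (circle_pt y r t) ^+ 2)) =
    (fun t => -1 * ln (C + enorm (circle_pt y r t) ^+ 2)).
  by apply/funext => t; rewrite mulN1r.
rewrite !period_integralZ; [|exact: cl..].
rewrite iP iQ.
have D0 : 0 < C + enorm y ^+ 2 by rewrite ltr_wpDr // sqr_ge0.
have D1 : 0 < 1 + enorm y ^+ 2 by rewrite ltr_wpDr // sqr_ge0.
move: ineq; rewrite -ler_ln ?posrE ?mulr_gt0 ?exprn_gt0 //.
rewrite (lnM (x := Q ^+ 2)) ?(lnM (x := P)) ?posrE ?exprn_gt0 //.
rewrite !lnXn // !mulr2n => ineq.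
have pi2 : 0 <= 2 * pi :> R by rewrite mulr_ge0 // pi_ge0.
rewrite mulN1r mulrCA -mulrBr ler_wpM2l //.
by lra.
Qed.

Lemma barrier_ge C y : 1 <= C -> C <= enorm y -> 2 <= enorm y ->
  ln (enorm y) <= barrier C y.
Proof.
move=> C1; set x := enorm y => Cx x2.
have x0 : 0 < x by lra.
have D0 : 0 < C + x ^+ 2 by nra.
have D1 : 0 < 1 + x ^+ 2 by nra.
suff : x * (C + x ^+ 2) <= (1 + x ^+ 2) ^+ 2.
  rewrite -ler_ln ?posrE ?mulr_gt0 ?exprn_gt0 //.
  by rewrite (lnM (x := x)) ?posrE // lnXn // -mulr_natl /barrier -/x; lra.
have : C * x <= x * x by rewrite ler_pM2r.
nra.
Qed.
End LogMean.

(** * Rigidity of integrals of lower semicontinuous functions *)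

Section Rigidity.
Context {R : realType}.
Local Notation mu := (@lebesgue_measure R).

(** Monotonicity of the integral for functions whose integral may be
    infinite: the positive parts and the negative parts compare separately. *)
Lemma le_integral_measurable d (T : measurableType d)
  (nu : {measure set T -> \bar R}) (D : set T) (u v : T -> \bar R) :
  measurable D -> measurable_fun D u -> measurable_fun D v ->
  (forall t, D t -> (u t <= v t)%E) ->
  (\int[nu]_(t in D) u t <= \int[nu]_(t in D) v t)%E.
Proof.
move=> mD mu_ mv uv.
have uvD : {in D, forall t, (u t <= v t)%E} by move=> t; rewrite inE; exact: uv.
rewrite [leLHS]integralE [leRHS]integralE; apply: leeB; apply: ge0_le_integral => //.
- exact: measurable_funepos.
- exact: measurable_funepos.
- by move=> t Dt; apply: (funepos_le uvD); rewrite inE.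
- exact: measurable_funeneg.
- exact: measurable_funeneg.
- by move=> t Dt; apply: (funeneg_le uvD); rewrite inE.
Qed.

Lemma lt_EFinD (a : R) (y : \bar R) : (a%:E < y)%E ->
  exists2 e : R, 0 < e & ((a + e)%:E < y)%E.
Proof.
case: y => [y| |] //; last by exists 1; rewrite ?ltry.
by rewrite lte_fin => ay; exists ((y - a) / 2); rewrite ?lte_fin; lra.
Qed.

(** A lower semicontinuous function that lies above a continuous one cannot
    exceed it at a single point without exceeding it on an interval. *)
Lemma integral_rigidity (u : R -> \bar R) (h : R -> R) (a b : R) : a < b ->
  lower_semicontinuous u -> continuous h ->
  (forall t, ((h t)%:E <= u t)%E) ->
  (\int[mu]_(t in `[a, b]) u t <= (\int[mu]_(t in `[a, b]) h t)%:E)%E ->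
  forall t, a <= t <= b -> u t = (h t)%:E.
Proof.
move=> ab lu ch hu le t /andP[at_ tb]; apply/eqP; rewrite eq_le hu andbT leNgt.
apply/negP => /lt_EFinD[e e0 hut].
have [V Vt uV] := lu _ _ hut.
have [d d0 dP] : exists2 d : R, 0 < d &
    forall s, `|t - s| < d -> ((h s + e / 2)%:E < u s)%E.
  have h2 : nbhs t [set s | h s < h t + e / 2].
    have ht : h t < h t + e / 2 by lra.
    exact: (ch t _ (lt_nbhsl ht)).
  have /nbhs_ballP[d /= d0 dV] : nbhs t (V `&` [set s | h s < h t + e / 2]).
    exact: filterI.
  exists d => // s sd; have [/uV us hs] := dV s sd.
  by apply: lt_trans us; rewrite lte_fin; rewrite /= in hs; lra.
(* an interval around [t], cut down to [a, b], on which [u] exceeds [h] by [e / 2] *)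
pose c1 := Num.max a (t - d / 2); pose c2 := Num.min b (t + d / 2).
have c12 : c1 < c2.
  by rewrite /c1 /c2 gt_max !lt_min; apply/andP; split; apply/andP; split; lra.
have cd s : c1 <= s <= c2 -> `|t - s| < d.
  rewrite /c1 /c2 ge_max le_min => /andP[/andP[? ?] /andP[? ?]].
  by rewrite ltr_norml; apply/andP; split; lra.
have sub : [set` `[c1, c2]] `<=` [set` `[a, b]].
  move=> s; rewrite /= !in_itv /= /c1 /c2 ge_max le_min.
  by move=> /andP[/andP[-> _] /andP[-> _]].
pose J := [set` `[c1, c2]].
pose k s := e / 2 * \1_J s.
have ih : mu.-integrable `[a, b] (EFin \o h) by exact: integrable_continuous.
have iJ : mu.-integrable `[a, b] (EFin \o \1_J).
  by apply: integrableS (integrable_indic_itv c1 c2 true false).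
have ik : mu.-integrable `[a, b] (EFin \o k).
  rewrite (_ : EFin \o k = (fun s => (e / 2)%:E * (EFin \o \1_J) s)%E) //.
  by apply: integrableZl.
have lt : ((\int[mu]_(t in `[a, b]) h t)%:E
   < (\int[mu]_(s in `[a, b]) ((EFin \o h) \+ (EFin \o k)) s)%E)%E.
  rewrite integralD // /Rintegral fineK; last exact: integrable_fin_num.
  rewrite lteDl; last exact: integrable_fin_num.
  rewrite (_ : EFin \o k = (fun s => (e / 2)%:E * (EFin \o \1_J) s)%E) //.
  rewrite integralZl //.
  rewrite integral_indic //.
  - have mJ : (mu (J `&` [set` `[a, b]]) = (c2 - c1)%:E)%E.
      by rewrite (setIidl sub) lebesgue_measure_itv /= lte_fin c12.
    apply: mule_gt0; first by rewrite lte_fin; lra.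
    by change (0 < mu (J `&` [set` `[a, b]]))%E; rewrite mJ lte_fin; lra.
  - exact: measurable_itv.
suff : (\int[mu]_(s in `[a, b]) ((EFin \o h) \+ (EFin \o k)) s <=
        \int[mu]_(s in `[a, b]) u s)%E by move=> /le_trans/(_ le); rewrite leNgt lt.
apply: le_integral_measurable => //.
- apply: emeasurable_funD; [exact: (measurable_int mu ih)|exact: (measurable_int mu ik)].
- by apply: measurable_funTS; exact: lower_semicontinuous_measurable.
- move=> s _; rewrite /= /k indicE -EFinD; case: (boolP (s \in J)) => /=.
    rewrite inE /J /= in_itv /= => /cd/dP/ltW sd.
    by rewrite mulr1.
  by rewrite mulr0 addr0.
Qed.
End Rigidity.

(** * Minima of lower semicontinuous functions *)

Section LowerSemicontinuous.
Context {R : realType}.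

Lemma lt_EFin_between (x y : \bar R) : (x < y)%E ->
  exists2 a : R, (x < a%:E)%E & (a%:E < y)%E.
Proof.
case: x => [x| |].
- by move=> /lt_EFinD[e e0 ?]; exists (x + e) => //; rewrite lte_fin; lra.
- by rewrite ltNge leey.
- case: y => [y| |] // _; last by exists 0; rewrite ?ltNyr ?ltry.
  by exists (y - 1); rewrite ?ltNyr ?lte_fin //; lra.
Qed.

Lemma lower_semicontinuous_comp (S T : topologicalType) (f : T -> \bar R)
    (c : S -> T) :
  lower_semicontinuous f -> continuous c -> lower_semicontinuous (f \o c).
Proof.
move=> lf cc x a /lf[V Vx aV]; exists (c @^-1` V) => [|y Vy]; last exact: aV.
exact: cc.
Qed.

Lemma lower_semicontinuousD (T : topologicalType) (f : T -> \bar R) (g : T -> R) :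
  lower_semicontinuous f -> continuous g ->
  lower_semicontinuous (fun x => f x + (g x)%:E)%E.
Proof.
move=> lf cg x a; rewrite -lteBlDr // -EFinB => /lt_EFinD[e e0].
move=> /lf[V Vx aV].
have h2 : nbhs x [set y | g x - e < g y].
  have gx : g x - e < g x by lra.
  exact: (cg x _ (lt_nbhsr gx)).
exists (V `&` [set y | g x - e < g y]); first exact: filterI.
move=> y [Vy /= gy]; rewrite -lteBlDr // -EFinB.
by apply: le_lt_trans (aV _ Vy); rewrite lee_fin; lra.
Qed.

Lemma lower_semicontinuous_closed (T : topologicalType) (f : T -> \bar R) (l : \bar R) :
  (-oo < l)%E -> lower_semicontinuous f -> closed [set x | (f x <= l)%E].
Proof.
move=> l0 /lower_semicontinuousP lf.
rewrite (_ : [set x | _] = ~` [set x | (l < f x)%E]); last first.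
  by apply/seteqP; split => x /=; [rewrite leNgt => /negP|move/negP; rewrite -leNgt].
apply: open_closedC; case: l l0 => [l| |] // _.
rewrite (_ : [set x | _] = set0); first exact: open0.
by apply/seteqP; split => x //=; rewrite ltNge leey.
Qed.

(** If the infimum [m] were not attained, each point would have a neighbourhood
    on which [f] exceeds some real [a > m]; compactness makes [a] uniform. *)
Lemma lower_semicontinuous_compact_min (T : topologicalType) (f : T -> \bar R)
    (K : set T) :
  compact K -> K !=set0 -> lower_semicontinuous f ->
  exists2 p, K p & forall x, K x -> (f p <= f x)%E.
Proof.
move=> cK [x0 Kx0] lf; apply: contrapT => nmin.
set m := ereal_inf (f @` K).
have mle x : K x -> (m <= f x)%E.
  by move=> Kx; apply: ereal_inf_lbound; exists x.
have mlt p : K p -> (m < f p)%E.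
  move=> Kp; rewrite ltNge; apply/negP => fpm; apply: nmin; exists p => // x Kx.
  exact: le_trans fpm (mle x Kx).
have between p : K p -> exists2 a : R, (m < a%:E)%E & (a%:E < f p)%E.
  by move=> /mlt/lt_EFin_between.
pose F : set_system R :=
  filter_from [set a : R | (m < a%:E)%E] (fun a => [set b | b <= a /\ (m < b%:E)%E]).
have FF : Filter F.
  apply: filter_from_filter; first by have [a ma _] := between _ Kx0; exists a.
  move=> a b /= ma mb; exists (Num.min a b).
    by rewrite /=; case: (leP a b).
  by move=> c /= [cab mc]; move: cab; rewrite le_min => /andP[? ?].
have : \forall b \near F, K `<=` (fun x => (b%:E < f x)%E).
  move/compact_near_coveringP : cK; apply => x Kx.
  have [a ma /lf[V Vx aV]] := between x Kx.
  exists (V, [set b | b <= a /\ (m < b%:E)%E]).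
    by split => //=; exists a.
  move=> [y b] [/= Vy [ba _]]; apply: le_lt_trans (aV _ Vy).
  by rewrite lee_fin.
move=> [a /= ma aF]; have Ka := aF a (conj (lexx a) ma).
have : (a%:E <= m)%E.
  by apply: le_ereal_inf_tmp => _ [x Kx <-]; exact/ltW/Ka.
by rewrite leNgt ma.
Qed.

End LowerSemicontinuous.

(** * Supermedian functions attain their minimum *)

Section PlaneMinimum.
Context {R : realType}.
Implicit Types (x y p q : R * R) (f : R * R -> \bar R) (r : R * R -> R).

Lemma compact_disk (N : R) : compact [set x : R * R | enorm x <= N].
Proof.
have cS : compact (`[- N, N]%classic `*` `[- N, N]%classic).
  by apply: compact_setX; exact: segment_compact.
apply: subclosed_compact cS _.
  apply: (@preimage_closed _ _ (@enorm R) [set t | t <= N]).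
    by move=> x _; exact: continuous_enorm.
  exact: closed_le.
have comp (a b : R) : Num.sqrt (a ^+ 2 + b ^+ 2) <= N -> a \in `[- N, N].
  move=> abN; rewrite in_itv /= -ler_norml; apply: le_trans abN.
  by rewrite -sqrtr_sqr ler_wsqrtr // lerDl sqr_ge0.
move=> x /= xN; split; first exact: (comp x.1 x.2).
by apply: (comp x.2 x.1); rewrite addrC.
Qed.

(** The minimum points of a coercive function form a compact set, so that one of
    them is farthest from the origin.  The circle about it reaches farther out,
    hence carries points that are not minimal. *)
Lemma farthest_minimum f x1 (N : R) : (forall x, (-oo < f x)%E) ->
  lower_semicontinuous f ->
  (forall x, N < enorm x -> (f x1 < f x)%E) ->
  exists p, (forall x, (f p <= f x)%E) /\
    (forall q, (f q <= f p)%E -> enorm q <= enorm p).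
Proof.
move=> fNy lf coer; pose D := [set x : R * R | enorm x <= Num.max N (enorm x1)].
have Dx1 : D x1 by rewrite /D /= le_max lexx orbT.
have cD : compact D by exact: compact_disk.
have [p0 Dp0 p0min] := lower_semicontinuous_compact_min cD (ex_intro _ _ Dx1) lf.
have out x : ~ D x -> (f x1 < f x)%E.
  move=> /negP; rewrite -ltNge gt_max => /andP[Nx _]; exact: coer.
have gmin x : (f p0 <= f x)%E.
  have [/p0min//|/out/ltW] := pselect (D x).
  exact/le_trans/p0min.
pose B := [set x | (f x <= f p0)%E].
have BD : B `<=` D.
  move=> x; rewrite /B /= => fx; apply: contrapT => /out.
  by rewrite ltNge (le_trans fx) // gmin.
have cB : compact B.
  apply: subclosed_compact BD => //.
  exact: lower_semicontinuous_closed.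
have B0 : B !=set0 by exists p0; rewrite /B /=.
have [|p pB pmax] := compact_EVT_max (f := @enorm R) B0 cB.
  exact/continuous_subspaceT/continuous_enorm.
move: pB; rewrite inE /B /= => fp.
exists p; split => [x|q fq]; first exact: le_trans fp (gmin x).
by apply: pmax; rewrite inE /B /=; exact: le_trans fq fp.
Qed.

(** Equality case in the comparison of circular means: if [f] lies above [g] and
    its mean does not exceed that of [g], then [f] and [g] agree on the
    circle. *)
Lemma circle_mean_rigidity f (g : R * R -> R) x (rho : R) :
  lower_semicontinuous f -> continuous g ->
  (forall y, ((g y)%:E <= f y)%E) ->
  (circle_mean f x rho <=
    ((2 * pi)^-1 * period_integral (fun t => g (circle_pt x rho t)))%:E)%E ->
  forall t, 0 <= t <= 2 * pi -> f (circle_pt x rho t) = (g (circle_pt x rho t))%:E.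
Proof.
move=> lf cg gf le; have pi0 : 0 < 2 * pi :> R by have := pi_gt0 R; lra.
have cc : continuous (circle_pt x rho).
  by apply: (@continuous_circle_pt R x (cst rho)) => t; exact: cvg_cst.
apply: (@integral_rigidity R (f \o circle_pt x rho) (g \o circle_pt x rho)) => //.
- exact: lower_semicontinuous_comp.
- by move=> t; apply: (@continuous_comp _ _ _ (circle_pt x rho) g); [exact: cc|exact: cg].
- by move=> t; exact: gf.
move: le; rewrite /circle_mean EFinM lee_pmul2l // ?lte_fin ?invr_gt0 //.
Qed.

Lemma plane_infty_sup_lt (h : R * R -> R) :
  (limf_esup (fun x => (h x)%:E) (plane_infty R) < +oo)%E ->
  exists N A, forall x, N < enorm x -> h x <= A.
Proof.
move=> /ereal_inf_lt[_ [V [N _ NV] <-] supV].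
have [A hA] : exists A : R, (ereal_sup ((fun x => (h x)%:E) @` V) <= A%:E)%E.
  move: supV; case: ereal_sup => [s| |] // _; first by exists s.
  by exists 0; exact: leNye.
exists N, A => x Nx; rewrite -lee_fin; apply: le_trans hA.
by apply: ereal_sup_ubound; exists x => //; exact: NV.
Qed.

Lemma plane_infty_inf_gt (h : R * R -> \bar R) (a : \bar R) :
  (a < limf_einf h (plane_infty R))%E ->
  exists N, forall x, N < enorm x -> (a < h x)%E.
Proof.
rewrite limf_einfE => /ereal_sup_gt[_ [V [N _ NV] <-] infV].
exists N => x Nx; apply: lt_le_trans infV _.
by apply: ereal_inf_lbound; exists x => //; exact: NV.
Qed.

Lemma plane_infty_infNy (h : R * R -> R) :
  limf_einf (fun x => (h x)%:E) (plane_infty R) = -oo%E ->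
  forall N A, exists2 x, N < enorm x & h x < A.
Proof.
rewrite limf_einfE => e N A; apply: contrapT => no.
have : (A%:E <= -oo)%E; last by rewrite leNgt ltNyr.
rewrite -e; apply: le_trans (ereal_sup_ubound _); last first.
  by exists [set x | N < enorm x] => //; exists N.
apply: le_ereal_inf_tmp => _ [x Nx <-]; rewrite lee_fin leNgt.
by apply/negP => hx; apply: no; exists x.
Qed.

Lemma radius_bound r : continuous r ->
  (limf_esup (fun x => (r x - enorm x)%:E) (plane_infty R) < +oo)%E ->
  exists2 M, 1 <= M & forall x, r x <= enorm x + M.
Proof.
move=> cr /plane_infty_sup_lt[N [A rA]].
have D0 : [set x : R * R | enorm x <= Num.max N 0] !=set0.
  by exists 0; rewrite /= /enorm /= expr0n addr0 sqrtr0 le_max lexx orbT.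
have [|p _ pmax] := compact_EVT_max (f := r) D0 (@compact_disk _).
  exact: continuous_subspaceT.
exists (Num.max 1 (Num.max A (r p))); first by rewrite le_max lexx.
move=> x; have [xN|] := leP (enorm x) (Num.max N 0).
  rewrite (le_trans (pmax x _)) ?inE //.
  by rewrite ler_wpDl ?enorm_ge0 // !le_max lexx !orbT.
rewrite gt_max => /andP[/rA xA _].
by rewrite -lerBlDl !le_max xA !orbT.
Qed.

Lemma log_growth f (e : R) : 0 < e -> (forall x, (-oo < f x)%E) ->
  (0 <= limf_einf (fun x => f x / (ln (enorm x))%:E) (plane_infty R))%E ->
  exists N, forall x, N < enorm x -> ((- e * ln (enorm x))%:E <= f x)%E.
Proof.
move=> e0 fNy f0.
have /plane_infty_inf_gt[N NP] :
    ((- e)%:E < limf_einf (fun x => f x / (ln (enorm x))%:E) (plane_infty R))%E.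
  by apply: lt_le_trans f0; rewrite lte_fin; lra.
exists (Num.max N 1) => x; rewrite gt_max => /andP[/NP Nx x1].
have l0 : 0 < ln (enorm x) by exact: ln_gt0.
move: Nx (fNy x); case: (f x) => [y| |] // Nx _; last exact: leey.
move: Nx; rewrite inver gt_eqF // -EFinM lte_fin lee_fin => /ltW.
by rewrite ler_pdivlMr.
Qed.

(** For each [e > 0] the function [F = f + e L], where [L] is the barrier, is
    coercive.  At its farthest minimum point [p], if [p] is outside the disk [K]
    beyond which [L] has negative drift, [f] is touched from below by
    [F p - e L], whose mean over the circle about [p] is at least its value at
    [p]; by rigidity the whole circle would consist of minimum points of [F],
    some of them farther out.  So [F] attains its minimum in [K], where [e L] is
    bounded below by a multiple of [e]; letting [e] tend to zero, the minimum of
    [f] over [K] is its minimum over the plane. *)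
Lemma supermedian_attains_min r f : (forall x, 0 < r x) -> continuous r ->
  (limf_esup (fun x => (r x - enorm x)%:E) (plane_infty R) < +oo)%E ->
  (forall x, (-oo < f x)%E) -> lower_semicontinuous f ->
  (0 <= limf_einf (fun x => f x / (ln (enorm x))%:E) (plane_infty R))%E ->
  supermedian r f ->
  exists p, forall x, (f p <= f x)%E.
Proof.
move=> r0 cr rsup fNy lf f0 sm.
have [[x1 fx1]|noreal] := pselect (exists x, (f x < +oo)%E); last first.
  exists 0 => x; suff -> : f x = +oo%E by exact: leey.
  apply/eqP; rewrite -leye_eq leNgt; apply/negP => fx.
  by apply: noreal; exists x.
have [M M1 rM] := radius_bound cr rsup.
pose N := 32 * M; pose C := 14 * N ^+ 2; pose K := [set x : R * R | enorm x <= 2 * N * C].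
have N1 : 1 <= N by rewrite /N; lra.
have C1 : 1 <= C by rewrite /C; nra.
have cK : compact K := @compact_disk _.
have K0 : K !=set0.
  by exists 0; rewrite /K /= /enorm /= expr0n addr0 sqrtr0 !mulr_ge0 //; lra.
have cL : continuous (barrier C) by apply: continuous_barrier; lra.
have [k Kk kmin] := lower_semicontinuous_compact_min cK K0 lf.
have [|l _ lmin] := compact_EVT_min (f := barrier C) K0 cK.
  exact: continuous_subspaceT.
set L := barrier C in cL lmin.
have key (e : R) x : 0 < e -> (f k + (e * L l)%:E <= f x + (e * L x)%:E)%E.
  move=> e0; pose F x := (f x + (e * L x)%:E)%E.
  have ceL : continuous (fun x => e * L x).
    by move=> y; apply: cvgM; [exact: cvg_cst|exact: cL].
  have lF : lower_semicontinuous F by exact: lower_semicontinuousD.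
  have FNy y : (-oo < F y)%E.
    by rewrite /F; move: (fNy y); case: (f y) => [z| |] // _; exact: ltNyr.
  have [a aE] : exists a : R, F x1 = a%:E.
    by rewrite /F; move: fx1 (fNy x1); case: (f x1) => [b| |] // _ _; exists (b + e * L x1).
  have e2 : 0 < e / 2 by lra.
  have [N0 N0P] := log_growth e2 fNy f0.
  (* Beyond [B], [f >= - (e / 2) ln] and [L >= ln], so that [F >= (e / 2) ln > a]. *)
  pose B := Num.max (Num.max N0 (Num.max C 2)) (expR (2 * a / e)).
  have coer y : B < enorm y -> (F x1 < F y)%E.
    rewrite /B !gt_max => /andP[/andP[/N0P fy /andP[yC y2]] ya].
    have y0 : 0 < enorm y by lra.
    have Ly := barrier_ge C1 (ltW yC) (ltW y2); rewrite -/L in Ly.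
    have lny : 2 * a / e < ln (enorm y) by rewrite -ltr_expR lnK.
    rewrite ltr_pdivrMr // in lny.
    rewrite aE; apply: lt_le_trans (leeD2r _ fy).
    have : e * ln (enorm y) <= e * L y by rewrite ler_pM2l.
    by rewrite -EFinD lte_fin; lra.
  have [p [pmin pfar]] := farthest_minimum FNy lF coer.
  have pK : K p.
    rewrite /K /= leNgt; apply/negP => pout.
    have [b bE] : exists b : R, F p = b%:E.
      move: (pmin x1) (FNy p); rewrite aE; case: (F p) => [b| |] //.
      by exists b.
    pose g y := b - e * L y.
    have cg : continuous g by move=> y; apply: cvgB; [exact: cvg_cst|exact: ceL].
    have gf y : ((g y)%:E <= f y)%E.
      by rewrite /g EFinB leeBlDr // -bE; exact: pmin.
    have fp : f p = (g p)%:E.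
      move: bE; rewrite /F /g; case: (f p) => [y| |] //= -[<-].
      by rewrite addrK.
    have cLc : continuous (fun t => L (circle_pt p (r p) t)).
      move=> t; apply: (@continuous_comp _ _ _ (circle_pt p (r p)) L); last exact: cL.
      by apply: (@continuous_circle_pt R p (cst (r p))) => s; exact: cvg_cst.
    have Lmean : period_integral (fun t => L (circle_pt p (r p) t)) <= 2 * pi * L p.
      by apply: (@barrier_supermean R M N) => //; exact: ltW.
    have pi2 : 0 < 2 * pi :> R by rewrite mulr_gt0 // pi_gt0.
    have gmean : g p <= (2 * pi)^-1 * period_integral (fun t => g (circle_pt p (r p) t)).
      rewrite ler_pdivlMl // /g.
      have -> : (fun t => b - e * L (circle_pt p (r p) t)) =
          (fun t => b + - e * L (circle_pt p (r p) t)).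
        by apply/funext => t; rewrite mulNr.
      rewrite period_integralD; first last.
      - by move=> t; apply: cvgM; [exact: cvg_cst|exact: cLc].
      - by move=> t; exact: cvg_cst.
      rewrite period_integral_cst period_integralZ // mulrBr lerD2l mulNr lerN2.
      by rewrite mulrCA ler_pM2l.
    have [s s2 sE] := sqr_enorm_circle_pt p (r p).
    have fs : f (circle_pt p (r p) s) = (g (circle_pt p (r p) s))%:E.
      apply: circle_mean_rigidity => //.
      by apply: le_trans (sm p) _; rewrite fp lee_fin.
    (* The angle [s] points away from the origin. *)
    have : enorm (circle_pt p (r p) s) <= enorm p.
      by apply: pfar; rewrite bE /F fs -EFinD lee_fin /g subrK.
    have rp := r0 p; have np := enorm_ge0 p.
    move/(sqr_le (enorm_ge0 _)); rewrite sE subrr cos0; nra.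
  have Llp : L l <= L p by apply: lmin; rewrite inE.
  apply: le_trans (pmin x); apply: leeD; first exact: kmin.
  by rewrite lee_fin ler_pM2l.
have [c cE] : exists c : R, f k = c%:E.
  move: (key 1 x1 ltr01) (fNy k) fx1; case: (f k) => [c| |] //; first by exists c.
  by case: (f x1).
exists k => x; rewrite cE; move: (key^~ x) (fNy x); rewrite cE.
case: (f x) => [y| |] // keyx _; last exact: leey.
rewrite lee_fin leNgt; apply/negP => yc.
(* At [(c - y) / d] the quantity [e (L x - L l)] stays below the gap [c - y]. *)
pose d := `|L x - L l| + 1.
have d0 : 0 < d by rewrite /d ltr_wpDl.
have dle : L x - L l < d by rewrite /d (le_lt_trans (ler_norm _)) // ltrDl.
have e0 : 0 < (c - y) / d by rewrite divr_gt0 // subr_gt0.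
have := keyx _ e0; rewrite lee_fin.
have : (c - y) / d * (L x - L l) < (c - y) / d * d by rewrite ltr_pM2l.
rewrite divfK ?gt_eqF //; lra.
Qed.
End PlaneMinimum.

(** * Closed sets that contain the circles about their points *)

Section CircleClosed.
Context {R : realType}.

Lemma continuous_root (h : R -> R) a b : continuous h -> h a <= 0 -> 0 <= h b ->
  exists t, h t = 0.
Proof.
move=> ch; wlog ab : h a b ch / a <= b => [hw ha hb|ha hb].
  have [ab|/ltW ba] := leP a b; first exact: (hw h a b).
  have [|||t /eqP] := hw (fun t => - h t) b a _ ba.
  - by move=> t; apply: cvgN; exact: ch.
  - by rewrite oppr_le0.
  - by rewrite oppr_ge0.
  - by rewrite oppr_eq0 => /eqP; exists t.
have [|c _ c0] := @IVT R h a b 0 ab (continuous_subspaceT ch).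
  by rewrite ge_min ha le_max hb orbT.
by exists c.
Qed.

Context (r : R * R -> R) (A : set (R * R)) (y : R * R) (M : R).
Context (r_gt0 : forall x, 0 < r x) (r_cont : continuous r).
Context (A_circle : forall x t, A x -> A (circle_pt x (r x) t)).
Context (Ay : ~ A y).
Context (rM : forall x, r x <= enorm (x - y) + M).

Lemma in_circle x z : A x -> enorm (z - x) = r x -> A z.
Proof. by move=> Ax /(circle_ptP (ltW (r_gt0 x)))[t _ ->]; exact: A_circle. Qed.

(** No circle centred in [A] passes through [y]; so on a connected part of [A]
    either all the circles enclose [y] or none does. *)
Lemma dist_center_neq x : A x -> enorm (x - y) != r x.
Proof.
by move=> Ax; apply/eqP => e; apply/Ay/(in_circle Ax); rewrite enormB_sym.
Qed.

(** Curves around [y] inside [A], in polar coordinates centred at [y].  The angle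
    ranges over the whole line, which turns connectedness of the curve into
    intermediate values on the line. *)
Definition polar_curve (rho : R -> R) :=
  [/\ continuous rho, forall t, 0 < rho t & forall t, A (circle_pt y (rho t) t)].

Lemma continuous_along rho : continuous rho ->
  continuous (fun t => r (circle_pt y (rho t) t)).
Proof.
move=> crho t; apply: (@continuous_comp _ _ _ (fun t => circle_pt y (rho t) t) r).
  exact: continuous_circle_pt.
exact: r_cont.
Qed.

Lemma polar_curve_sign rho : polar_curve rho ->
  (forall t, r (circle_pt y (rho t) t) < rho t) \/
  (forall t, rho t < r (circle_pt y (rho t) t)).
Proof.
move=> [crho rho0 Arho]; set h := fun t => rho t - r (circle_pt y (rho t) t).
have ch : continuous h.
  by move=> t; apply: cvgB; [exact: crho|exact: continuous_along].
have hN0 t : h t != 0.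
  rewrite subr_eq0; have := dist_center_neq (Arho t).
  by rewrite enorm_circle_pt // ltW.
have [[a ha]|noneg] := pselect (exists t, h t < 0).
  right => t; rewrite -subr_lt0 ltNge; apply/negP => ht.
  have [c c0] := continuous_root ch (ltW ha) ht.
  by move: (hN0 c); rewrite c0 eqxx.
left => t; rewrite -subr_gt0 lt_neqAle eq_sym hN0 /= leNgt; apply/negP => ht.
by apply: noneg; exists t.
Qed.

(** Let [z] be the point at distance [s] from [y] in direction [t0].  If [z] is
    in the closed disk about the point of the curve in direction [t0], and not in
    the open disk about the point in the opposite direction, then somewhere
    between these two points of the curve a circle passes through [z]. *)
Lemma polar_curve_hit rho s t0 : polar_curve rho -> 0 <= s ->
  `|rho t0 - s| <= r (circle_pt y (rho t0) t0) ->
  r (circle_pt y (rho (t0 + pi)) (t0 + pi)) <= rho (t0 + pi) + s ->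
  A (circle_pt y s t0).
Proof.
move=> [crho rho0 Arho] s0 near far; set z := circle_pt y s t0.
pose h t := enorm (z - circle_pt y (rho t) t) - r (circle_pt y (rho t) t).
have ch : continuous h.
  move=> t; apply: cvgB; last exact: continuous_along.
  apply: (@continuous_comp _ _ _ (fun t => z - circle_pt y (rho t) t) (@enorm R)).
    by apply: cvgB; [exact: cvg_cst|exact: continuous_circle_pt].
  exact: continuous_enorm.
have h0 : h t0 <= 0 by rewrite /h /z enorm_circle_ptB distrC subr_le0.
have h1 : 0 <= h (t0 + pi).
  rewrite /h /z {1}circle_pt_pi enorm_circle_ptB opprK subr_ge0 (addrC s).
  by rewrite ger0_norm // addr_ge0 // ltW.
have [t /eqP] := continuous_root ch h0 h1.
by rewrite /h subr_eq0 => /eqP; exact: in_circle.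
Qed.

(** The points of the circles farthest from [y], and those nearest to [y] when
    the circles do not enclose [y], trace polar curves again. *)
Lemma polar_curve_outward rho : polar_curve rho ->
  polar_curve (fun t => rho t + r (circle_pt y (rho t) t)).
Proof.
move=> [crho rho0 Arho]; split.
- by move=> t; apply: cvgD; [exact: crho|exact: continuous_along].
- by move=> t; rewrite addr_gt0.
- by move=> t; have := A_circle t (Arho t); rewrite circle_pt_radial.
Qed.

Lemma polar_curve_inward rho : polar_curve rho ->
  (forall t, r (circle_pt y (rho t) t) < rho t) ->
  polar_curve (fun t => rho t - r (circle_pt y (rho t) t)).
Proof.
move=> [crho rho0 Arho] lt; split.
- by move=> t; apply: cvgB; [exact: crho|exact: continuous_along].
- by move=> t; rewrite subr_gt0.
- move=> t; have := A_circle (t + pi) (Arho t).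
  by rewrite circle_pt_pi circle_pt_radial.
Qed.

Lemma continuous_radius_ray t : continuous (fun s => r (circle_pt y s t)).
Proof.
move=> s; apply: (@continuous_comp _ _ _ (fun s => circle_pt y s t) r); last exact: r_cont.
apply: (@cvg_pair _ _ _ _ (nbhs (y.1 + s * cos t)) (nbhs (y.2 + s * sin t)));
  (apply: cvgD; [exact: cvg_cst|apply: cvgM; [exact: cvg_id|exact: cvg_cst]]).
Qed.

Lemma radius_lower_bound (b t : R) : 0 <= b ->
  exists2 d, 0 < d & forall s, 0 <= s <= b -> d <= r (circle_pt y s t).
Proof.
move=> b0; have cu := @continuous_radius_ray t.
have [c _ cmin] := EVT_min b0 (continuous_subspaceT cu).
by exists (r (circle_pt y c t)) => // s s0b; apply: cmin; rewrite in_itv.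
Qed.

Lemma archimedean_mul (a d : R) : 0 < d -> exists n : nat, a < n%:R * d.
Proof.
by move=> d0; exists (Num.truncn (a / d)).+1; rewrite -ltr_pdivrMr // truncnS_gt.
Qed.

(** Moving outward repeatedly, the distance in a given direction grows by steps
    that are bounded below as long as it stays bounded. *)
Lemma polar_curve_reach rho s t0 : polar_curve rho -> 0 <= s ->
  exists2 rho', polar_curve rho' & s <= rho' t0.
Proof.
move=> prho s0; have [d d0 dr] := radius_lower_bound t0 s0.
have [n sn] := archimedean_mul s d0.
suff [rho' prho'] : exists2 rho', polar_curve rho' & Num.min s (n%:R * d) <= rho' t0.
  by rewrite ge_min => /orP[|/(lt_le_trans sn)/ltW] ?; exists rho'.
elim: n {sn} => [|n [rho' prho' IH]].
  exists rho => //; have [_ rho0 _] := prho.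
  by rewrite mul0r ge_min (ltW (rho0 t0)) orbT.
have [srho|rhos] := leP s (rho' t0).
  by exists rho' => //; rewrite ge_min srho.
exists (fun t => rho' t + r (circle_pt y (rho' t) t)); first exact: polar_curve_outward.
have [_ rho0 _] := prho'.
have dle : d <= r (circle_pt y (rho' t0) t0) by apply: dr; rewrite !ltW.
move: IH; rewrite !ge_min leNgt rhos /= => IH.
by rewrite -natr1 mulrDl mul1r; apply/orP; right; apply: lerD.
Qed.

(** If the circles along the curve enclose [y], they sweep everything inside the
    curve down to distance [M] from [y].  Otherwise they sweep the region between
    the curve and its inward image, and the argument continues with that image;
    each step moves inward by at least [d] in direction [t0], so that finitely
    many steps suffice. *)
Lemma polar_curve_fill rho s t0 : polar_curve rho -> 0 <= s -> M <= s ->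
  s <= rho t0 -> A (circle_pt y s t0).
Proof.
move=> prho s0 Ms; have [b] : exists b, rho t0 <= b by exists (rho t0).
have [_ rho0 _] := prho; move=> rhob.
have [d d0 dr] := radius_lower_bound t0 (le_trans (ltW (rho0 t0)) rhob).
have [n] := archimedean_mul (rho t0) d0.
elim: n rho prho rhob {rho0} => [|n IH] rho prho rhob rhon srho; have [_ rho0 _] := prho.
  by have := rho0 t0; rewrite mul0r in rhon; rewrite ltNge (ltW rhon).
have rd : d <= r (circle_pt y (rho t0) t0) by apply: dr; rewrite rhob ltW.
have [pos|neg] := polar_curve_sign prho; last first.
  apply: (polar_curve_hit prho) => //.
    by rewrite ger0_norm ?subr_ge0 //; have := neg t0; lra.
  apply: le_trans (rM _) _; rewrite enorm_circle_pt ?lerD2l //.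
  exact: ltW.
have [le|lt] := leP (rho t0 - r (circle_pt y (rho t0) t0)) s.
  apply: (polar_curve_hit prho) => //.
    by rewrite ger0_norm ?subr_ge0 //; lra.
  by apply: (le_trans (ltW (pos _))); rewrite lerDl.
apply: (IH _ (polar_curve_inward prho pos)); last exact: ltW.
- by have := r_gt0 (circle_pt y (rho t0) t0); lra.
- by rewrite -natr1 mulrDl mul1r in rhon; lra.
Qed.

(** Where the closed set [A] is nearest to [y], the prescribed circle has to
    enclose [y], so it is a curve around [y]. *)
Lemma polar_curve_exists : closed A -> A !=set0 -> exists rho, polar_curve rho.
Proof.
move=> cA [a Aa].
have [p Ap pmin] : exists2 p, A p & forall x, A x -> enorm (p - y) <= enorm (x - y).
  pose D := A `&` [set x | enorm x <= enorm (a - y) + enorm y].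
  have tri x : enorm x <= enorm (x - y) + enorm y.
    by rewrite -{1}(subrK y x); exact: enorm_triangle.
  have D0 : D !=set0 by exists a; split => //=; exact: tri.
  have cD : compact D.
    rewrite /D setIC; apply: compact_closedI => //; exact: compact_disk.
  have [|p] := compact_EVT_min (f := fun x : R * R => enorm (x - y)) D0 cD.
    apply: continuous_subspaceT => x.
    apply: (@continuous_comp _ _ _ (fun x : R * R => x - y) (@enorm R)).
      by apply: cvgB; [exact: cvg_id|exact: cvg_cst].
    exact: continuous_enorm.
  rewrite inE => -[Ap _] pmin; exists p => // x Ax.
  have [xa|xa] := leP (enorm x) (enorm (a - y) + enorm y).
    by apply: pmin; rewrite inE.
  have : enorm (p - y) <= enorm (a - y).
    by apply: pmin; rewrite inE; split => //=; exact: tri.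
  by have := tri x; lra.
set d := enorm (p - y) in pmin.
have dr : d < r p.
  rewrite ltNge le_eqVlt negb_or eq_sym dist_center_neq //=; apply/negP => rd.
  have [t _ pE] := circle_ptP (enorm_ge0 (p - y)) erefl.
  have := A_circle (t + pi) Ap; rewrite circle_pt_pi {1}pE circle_pt_radial -/d.
  move/pmin; rewrite enorm_circle_pt ?subr_ge0 ?(ltW rd) //.
  by have := r_gt0 p; lra.
have d2 : d ^+ 2 < r p ^+ 2 by have := enorm_ge0 (p - y); rewrite -/d; nra.
pose v := p - y; have vd : v.1 ^+ 2 + v.2 ^+ 2 = d ^+ 2 by rewrite -sqr_enorm.
pose u t := v.1 * cos t + v.2 * sin t.
pose w t := u t ^+ 2 + (r p ^+ 2 - d ^+ 2).
have cu : continuous u.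
  move=> t; apply: cvgD; (apply: cvgM; first exact: cvg_cst).
  - exact: continuous_cos.
  - exact: continuous_sin.
(* the positive root [rho] of [|y + rho e^(it) - p| = r p] *)
exists (fun t => u t + Num.sqrt (w t)); split.
- move=> t; apply: cvgD; first exact: cu.
  apply: (@continuous_comp _ _ _ w Num.sqrt); last exact: sqrt_continuous.
  by apply: cvgD; [apply: cvgM; exact: cu|exact: cvg_cst].
- move=> t; have : `|u t| < Num.sqrt (w t).
    by rewrite -sqrtr_sqr ltr_sqrt /w; have := sqr_ge0 (u t); lra.
  by have := ler_norm (- u t); rewrite normrN; lra.
- move=> t; apply: (in_circle Ap).
  have w0 : 0 <= w t by rewrite /w addr_ge0 ?sqr_ge0 ?subr_ge0 ?ltW.
  have sw := sqr_sqrtr w0.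
  apply/eqP; rewrite -(@eqrXn2 _ 2) ?enorm_ge0 ?ltW //; apply/eqP.
  rewrite sqr_enorm /circle_pt /=.
  set s := Num.sqrt _ in sw *.
  transitivity ((u t + s) ^+ 2 * (cos t ^+ 2 + sin t ^+ 2) - 2 * (u t + s) * u t
     + (v.1 ^+ 2 + v.2 ^+ 2)); first by rewrite /u /v /=; ring.
  rewrite cos2Dsin2 vd; rewrite /w in sw; lra.
Qed.

Lemma exterior_subset : closed A -> A !=set0 ->
  forall x, Num.max M 0 <= enorm (x - y) -> A x.
Proof.
move=> cA A0 x; rewrite ge_max => /andP[Mx x0].
have [rho prho] := polar_curve_exists cA A0.
have [t _ ->] := circle_ptP x0 erefl.
have [rho' prho' le] := polar_curve_reach t prho x0.
exact: (polar_curve_fill prho').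
Qed.

(** Once [A] contains the complement of a disk about [y] and one of its far
    circles does not enclose [y], connectedness forces the same for all of
    them, and the circles eat up the disk. *)
Lemma exterior_shrink (m d : R) x : 0 < d ->
  (forall z, m <= enorm (z - y) -> A z) -> m <= enorm (x - y) ->
  r x < enorm (x - y) ->
  (forall z, enorm (z - y) = m -> d <= r z) ->
  forall z, m - d <= enorm (z - y) -> A z.
Proof.
move=> d0 Am mx rx dr z zm.
have m0 : 0 < m.
  rewrite ltNge; apply/negP => m0; apply/Ay/Am.
  by apply: (le_trans m0); exact: enorm_ge0.
have [/Am//|zlt] := leP m (enorm (z - y)).
have pm : polar_curve (fun=> m).
  split => // [t|t]; first exact: cvg_cst.
  by apply: Am; rewrite enorm_circle_pt // ltW.
have [t1 _ xE] := circle_ptP (enorm_ge0 (x - y)) erefl.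
(* The circle about [x] leaves [y] outside; so does the one about the point at
   distance [m] on the same ray, as the segment between them lies in [A]. *)
have pos1 : r (circle_pt y m t1) < m.
  rewrite ltNge; apply/negP => neg.
  pose h u := Num.max u m - r (circle_pt y (Num.max u m) t1).
  have cmax : continuous (fun u => Num.max u m : R).
    by move=> u; apply: continuous_max; [exact: cvg_id|exact: cvg_cst].
  have ch : continuous h.
    move=> u; apply: cvgB; first exact: cmax.
    apply: (@continuous_comp _ _ _ (fun u => Num.max u m : R)
      (fun s => r (circle_pt y s t1))); [exact: cmax|exact: continuous_radius_ray].
  have h0 : h m <= 0 by rewrite /h maxxx subr_le0.
  have h1 : 0 <= h (enorm (x - y)).
    by rewrite /h (max_l mx) -xE subr_ge0 ltW.
  have [u /eqP] := continuous_root ch h0 h1; rewrite subr_eq0 => /eqP e.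
  have mu : m <= Num.max u m by rewrite le_max lexx orbT.
  have n : enorm (circle_pt y (Num.max u m) t1 - y) = Num.max u m.
    by rewrite enorm_circle_pt // (le_trans (ltW m0)).
  have : A (circle_pt y (Num.max u m) t1) by apply: Am; rewrite n.
  by move/dist_center_neq; rewrite n -e eqxx.
have [pos|/(_ t1)] := polar_curve_sign pm; last by rewrite ltNge ltW.
have [t _ zE] := circle_ptP (enorm_ge0 (z - y)) erefl.
rewrite zE; apply: (polar_curve_hit pm); first exact: enorm_ge0.
- have h : 0 <= m - enorm (z - y) by lra.
  rewrite ger0_norm //; apply: (@le_trans _ _ d); first by lra.
  by apply: dr; rewrite enorm_circle_pt // ltW.
- by apply: (le_trans (ltW (pos _))); rewrite lerDl enorm_ge0.
Qed.

(** [A] contains the exterior of a disk about [y], and far out there is a centre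
    whose circle does not enclose [y].  The exterior then grows inward by steps
    of the least radius over a disk, until it contains [y]. *)
Lemma circle_closed_absurd : closed A -> A !=set0 ->
  (forall N B, exists2 x, N < enorm x & r x - enorm x < B) -> False.
Proof.
move=> cA A0 rNy; set m0 := Num.max M 0; have m00 : 0 <= m0 by rewrite le_max lexx orbT.
have ext := exterior_subset cA A0.
have [x xN xB] := rNy (m0 + enorm y) (- enorm y).
have tri z : enorm z <= enorm (z - y) + enorm y.
  by rewrite -{1}(subrK y z); exact: enorm_triangle.
have mx : m0 < enorm (x - y) by have := tri x; lra.
have rx : r x < enorm (x - y) by have := tri x; lra.
have D0 : [set z : R * R | enorm z <= m0 + enorm y] !=set0.
  exists y => /=; lra.
have [|p _ pmin] := compact_EVT_min (f := r) D0 (@compact_disk R _).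
  exact: continuous_subspaceT.
have step n z : m0 - n%:R * r p <= enorm (z - y) -> A z.
  elim: n z => [|n IH] z; first by rewrite mul0r subr0; exact: ext.
  have le : m0 - n%:R * r p <= m0 by rewrite lerBlDr lerDl mulr_ge0 // ltW.
  rewrite -natr1 mulrDl mul1r opprD addrA.
  apply: (exterior_shrink (x := x) (r_gt0 p) IH) => //; first by lra.
  by move=> q qe; apply: pmin; rewrite inE /=; have := tri q; lra.
have [n nP] := archimedean_mul m0 (r_gt0 p).
apply/Ay/(step n); apply: le_trans (enorm_ge0 _); lra.
Qed.

End CircleClosed.

(** * The Liouville property *)

Theorem theorem1p1 (R : realType) (r : R * R -> R) (f : R * R -> \bar R)
  (r_gt0 : forall x, 0 < r x)
  (r_cont : continuous r)
  (r_limsup :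
    (limf_esup (fun x => (r x - enorm x)%:E) (plane_infty R) < +oo)%E)
  (r_liminf :
    limf_einf (fun x => (r x - enorm x)%:E) (plane_infty R) = -oo%E)
  (f_gtNy : forall x, (-oo < f x)%E)
  (f_lsc : lower_semicontinuous f)
  (f_liminf :
    (0 <= limf_einf (fun x => f x / (ln (enorm x))%:E) (plane_infty R))%E)
  (f_supermedian : supermedian r f) :
  exists c : \bar R, forall x, f x = c.
Proof.
have [p pmin] := supermedian_attains_min r_gt0 r_cont r_limsup f_gtNy f_lsc
  f_liminf f_supermedian.
have [M _ rM] := radius_bound r_cont r_limsup.
pose A := [set x | (f x <= f p)%E].
suff AT y : A y by exists (f p) => x; apply/eqP; rewrite eq_le pmin AT.
apply: contrapT => Ay.
have [c pc] : exists c, f p = c%:E.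
  move: Ay (f_gtNy p); rewrite /A /=; case: (f p) => [c| |] //; first by exists c.
  by rewrite leey.
have A_circle x t : A x -> A (circle_pt x (r x) t).
  move=> Ax; have fx : f x = c%:E.
    by apply/eqP; rewrite -pc eq_le pmin andbT.
  have [s s2 ->] := circle_ptP (ltW (r_gt0 x)) (enorm_circle_pt x t (ltW (r_gt0 x))).
  rewrite /A /= pc (circle_mean_rigidity (g := fun=> c) f_lsc _ _ _ s2) //.
  - by move=> z; exact: cvg_cst.
  - by move=> z; rewrite -pc.
  - apply: le_trans (f_supermedian x) _; rewrite fx period_integral_cst mulKf //.
    by rewrite mulf_neq0 // gt_eqF // pi_gt0.
have rMy x : r x <= enorm (x - y) + (M + enorm y).
  have := rM x; have := enorm_triangle (x - y) y; rewrite subrK; lra.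
apply: (circle_closed_absurd r_gt0 r_cont A_circle Ay rMy).
- exact: lower_semicontinuous_closed.
- by exists p; rewrite /A /=.
- exact: plane_infty_infNy.
Qed.
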